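(* Let $(X,d)$ be a metric space equipped with the metric topology. Then $X$, equipped with either the metric ls-structure or the $C_0$ ls-structure associated to $d$, is an hls-normal hls-space.
   Context: For $B\subseteq X$ and a family $\mathcal{U}$ of subsets of $X$, $\mathrm{st}(B,\mathcal{U})$ is the union of the elements of $\mathcal{U}$ meeting $B$; for a family $\mathcal{B}$, $\mathrm{st}(\mathcal{B},\mathcal{U})=\{\mathrm{st}(B,\mathcal{U})\mid B\in\mathcal{B}\}$. A large scale structure (ls-structure) on a set $X$ is a nonempty collection $\mathcal{L}$ of families of subsets of $X$ (the uniformly bounded families) such that: (i) if $\mathcal{B}_1\in\mathcal{L}$ and each element of $\mathcal{B}_2$ having more than one point is contained in some element of $\mathcal{B}_1$, then $\mathcal{B}_2\in\mathcal{L}$; (ii) $\mathcal{B}_1,\mathcal{B}_2\in\mathcal{L}$ implies $\mathrm{st}(\mathcal{B}_1,\mathcal{B}_2)\in\mathcal{L}$. A hybrid large scale space (hls-space) is a set with an ls-structure and a topology such that some uniformly bounded cover consists of open sets. Metric ls-structure of $(X,d)$: all families of subsets which refine $\{B(x,R)\mid x\in X\}$ for some $R>0$. $C_0$ ls-structure of $(X,d)$: all families $\mathcal{U}$ of subsets of $X$ such that for every $\varepsilon>0$ there is a ($d$-)bounded set $B\subseteq X$ such that $\mathrm{diam}(U)\leq\varepsilon$ for all $U\in\mathcal{U}$ not contained in $B$. A subset is bounded (in an ls-space) if it is an element of some uniformly bounded cover. The coarse component of a point $x$ is the union of all bounded sets containing $x$. A subset is weakly bounded if its intersection with every coarse component is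 bounded. $N$ is a coarse neighbourhood of $A$ if $A\subseteq N$ and for every uniformly bounded cover $\mathcal{U}$, $\mathrm{st}(A,\mathcal{U})\subseteq N\cup K$ for some weakly bounded $K$. $N$ is a topological neighbourhood of $A$ if $N$ contains an open set containing $\mathrm{cl}(A)$. $N$ is a hybrid neighbourhood of $A$ if it is both a topological and a coarse neighbourhood of $A$. An hls-space $X$ is hls-normal if for every closed $A\subseteq X$ and every hybrid neighbourhood $N$ of $A$ there is a closed $V\subseteq X$ such that $V$ is a hybrid neighbourhood of $A$ and $N$ is a hybrid neighbourhood of $V$. *)

(* Defs.v *)
From HB Require Import structures.
From mathcomp Require Import all_boot all_order all_algebra.
From mathcomp Require Import all_classical all_reals all_analysis.

Set Implicit Arguments.
Unset Strict Implicit.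
Unset Printing Implicit Defensive.

Import Order.TTheory GRing.Theory Num.Theory.

Local Open Scope classical_set_scope.
Local Open Scope ring_scope.

Section LargeScale.
Context {X : Type}.
Implicit Types (A B K N : set X) (U V : set (set X)) (L : set (set (set X))).

Definition star B U : set X := \bigcup_(W in [set W | U W /\ W `&` B !=set0]) W.

Definition star_family V U : set (set X) := [set star B U | B in V].

Definition refines U V : Prop := forall A, U A -> exists2 B, V B & A `<=` B.

Definition is_cover U : Prop := \bigcup_(B in U) B = [set: X].

Definition ls_structure L : Prop :=
  [/\ L !=set0,
      forall U1 U2, L U1 ->
        (forall A, U2 A -> (exists x y, [/\ A x, A y & x <> y]) ->
           exists2 B, U1 B & A `<=` B) ->
        L U2
    & forall U1 U2, L U1 -> L U2 -> L (star_family U1 U2)].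

Definition ls_bounded L B : Prop := exists U, [/\ L U, is_cover U & U B].

Definition coarse_component L (x : X) : set X :=
  \bigcup_(B in [set B | ls_bounded L B /\ B x]) B.

Definition weakly_bounded L K : Prop :=
  forall x, ls_bounded L (K `&` coarse_component L x).

Definition coarse_nbhd L A N : Prop :=
  A `<=` N /\
  forall U, L U -> is_cover U ->
    exists2 K, weakly_bounded L K & star A U `<=` N `|` K.

End LargeScale.

Section Hybrid.
Context {X : topologicalType}.
Implicit Types (A N : set X) (L : set (set (set X))).

Definition hls_space L : Prop :=
  ls_structure L /\
  exists U, [/\ L U, is_cover U & forall O, U O -> open O].

Definition topological_nbhd A N : Prop :=
  exists O, [/\ open O, closure A `<=` O & O `<=` N].

(* [hybrid_nbhd L A N]: [N] is a hybrid neighbourhood of [A]. *)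
Definition hybrid_nbhd L A N : Prop := topological_nbhd A N /\ coarse_nbhd L A N.

Definition hls_normal L : Prop :=
  forall A N, closed A -> hybrid_nbhd L A N ->
    exists V, [/\ closed V, hybrid_nbhd L A V & hybrid_nbhd L V N].

End Hybrid.

Section MetricLargeScale.
Context {R : realType} (X : metricType R).

(* Including 0 makes the diameter of the empty set 0 rather than -oo. *)
Definition diam (A : set X) : \bar R :=
  ereal_sup (0%E |` [set (mdist p.1 p.2)%:E | p in A `*` A]).

Definition metric_bounded (A : set X) : Prop := (diam A < +oo)%E.

Definition metric_ls : set (set (set X)) :=
  [set U | exists2 r : R, 0 < r & refines U (range (fun x : X => ball x r))].

Definition C0_ls : set (set (set X)) :=
  [set U | forall e : R, 0 < e ->
     exists2 B : set X, metric_bounded B &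
       forall W, U W -> ~ W `<=` B -> (diam W <= e%:E)%E].

End MetricLargeScale.

Arguments metric_ls {R} X _.
Arguments C0_ls {R} X _.

(* Main.v *)
(** In both structures the bounded sets are the metrically bounded ones, and [N]
    is a coarse neighbourhood of [A] iff, outside some bounded set, the complement
    of [N] is at distance at least [r] from [A]: for every [r > 0] in the metric
    structure, for some [r > 0] in the C_0 structure. The set of points at least
    as close to [A] as to the complement of the interior of [N] is then
    halfway between [A] and [N]: it only costs a factor 2 on [r]. *)

Require Import Defs.
From HB Require Import structures.
From mathcomp Require Import all_boot all_order all_algebra.
From mathcomp Require Import all_classical all_reals all_analysis.
From mathcomp Require Import lra.

Set Implicit Arguments.
Unset Strict Implicit.
Unset Printing Implicit Defensive.

Import Order.TTheory GRing.Theory Num.Theory.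

Local Open Scope classical_set_scope.
Local Open Scope ring_scope.

(** * Stars of sets *)

Lemma starS (X : Type) (A B : set X) (U : set (set X)) :
  A `<=` B -> star A U `<=` star B U.
Proof.
move=> AB y [W [UW [a [Wa /AB Ba]]] Wy].
by exists W => //; split => //; exists a.
Qed.

Lemma mem_star (X : Type) (A W : set X) (U : set (set X)) a y :
  U W -> W a -> A a -> W y -> star A U y.
Proof. by move=> UW Wa Aa Wy; exists W => //; split => //; exists a. Qed.

(** * Metric boundedness, separation near infinity and the midway set *)

Section MetricBounded.
Context {R : realType} {X : metricType R}.
Implicit Types (A B K : set X) (U : set (set X)).

Lemma open_mdistP A :
  open A <-> forall x, A x -> exists2 e, 0 < e & forall y, mdist x y < e -> A y.
Proof.
rewrite openE; split => [oA x /oA/nbhs_ballP[e e0]|oA x /oA[e e0 xeA]].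
  by rewrite ballEmdist => xeA; exists e.
by apply/nbhs_ballP; exists e => //; rewrite ballEmdist.
Qed.

Lemma diam_leP A e : 0 <= e ->
  (diam A <= e%:E)%E <-> forall x y, A x -> A y -> mdist x y <= e.
Proof.
move=> e0; split => [Ae x y Ax Ay|Ae].
  rewrite -lee_fin; apply: le_trans Ae; apply: ereal_sup_ubound; right.
  by exists (x, y).
apply: ge_ereal_sup => _ [->|[[x y] [Ax Ay] <-]]; rewrite lee_fin//=.
exact: Ae.
Qed.

Lemma metric_boundedP A :
  metric_bounded A <-> exists M, forall x y, A x -> A y -> mdist x y <= M.
Proof.
rewrite /metric_bounded; split => [Aoo|[M AM]].
  have A0 : (0 <= diam A)%E by apply: ereal_sup_ubound; left.
  have Afin : diam A \is a fin_num by rewrite ge0_fin_numE.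
  exists (fine (diam A)); apply/diam_leP; first exact: fine_ge0.
  by rewrite fineK.
(* [M] may be negative when [A] is empty, while [diam_leP] asks for a nonnegative bound. *)
apply: (@le_lt_trans _ _ (`|M|)%:E); last exact: ltry.
by apply/diam_leP => // x y Ax Ay; apply: le_trans (ler_norm _); exact: AM.
Qed.

Lemma metric_bounded_atP (x : X) A :
  metric_bounded A <-> exists M, forall y, A y -> mdist x y <= M.
Proof.
split=> [/metric_boundedP[M AM]|[M AM]].
  have [[a Aa]|A0] := pselect (A !=set0); last first.
    by exists 0 => y Ay; case: A0; exists y.
  exists (mdist x a + M) => y Ay.
  by apply: le_trans (metric_triangle x a y) _; rewrite lerD2l AM.
apply/metric_boundedP; exists (M + M) => y z Ay Az.
apply: le_trans (metric_triangle y x z) _.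
by rewrite metric_sym lerD ?AM.
Qed.

Lemma metric_boundedS A B : A `<=` B -> metric_bounded B -> metric_bounded A.
Proof.
move=> AB /metric_boundedP[M BM]; apply/metric_boundedP; exists M => x y Ax Ay.
by apply: BM; exact: AB.
Qed.

Lemma metric_bounded2 (x y : X) : metric_bounded [set x; y].
Proof.
apply/(metric_bounded_atP x); exists (mdist x y) => _ [] -> //.
by rewrite mdistxx mdist_ge0.
Qed.

Lemma metric_boundedU A B :
  metric_bounded A -> metric_bounded B -> metric_bounded (A `|` B).
Proof.
have [[x _]|A0 _] := pselect (A !=set0); last first.
  by apply: metric_boundedS => y [Ay|//]; case: A0; exists y.
move=> /(metric_bounded_atP x)[M AM] /(metric_bounded_atP x)[N BN].
apply/(metric_bounded_atP x); exists (Num.max M N) => y.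
by rewrite le_max => -[/AM ->|/BN ->]; rewrite ?orbT.
Qed.

Lemma metric_bounded_thickening r K : metric_bounded K ->
  metric_bounded [set y | exists2 x, K x & mdist x y <= r].
Proof.
move=> /metric_boundedP[M KM].
apply/metric_boundedP; exists (M + 2 * r) => x y [x' Kx xr] [y' Ky yr].
have := metric_triangle x x' y; have := metric_triangle x' y' y.
by have := KM _ _ Kx Ky; rewrite (metric_sym x x'); lra.
Qed.

(** Two-point sets are bounded, so any two points share a coarse component; weakly bounded sets are
    then just the bounded ones. *)
Lemma coarse_component_setT (L : set (set (set X))) (x : X) :
  (forall B, ls_bounded L B <-> metric_bounded B) ->
  coarse_component L x = [set: X].
Proof.
move=> LE; apply/seteqP; split => // y _.
exists [set x; y]; last by right.
by split; [apply/LE; exact: metric_bounded2|left].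
Qed.

Lemma weakly_bounded_metricP (L : set (set (set X))) K :
  (forall B, ls_bounded L B <-> metric_bounded B) ->
  weakly_bounded L K <-> metric_bounded K.
Proof.
move=> LE; split => [LK|bK x]; last first.
  by rewrite coarse_component_setT// setIT; apply/LE.
have [[x Kx]|K0] := pselect (K !=set0).
  by have := LK x; rewrite coarse_component_setT// setIT => /LE.
by apply/metric_boundedP; exists 0 => x ? Kx; case: K0; exists x.
Qed.

(** Collecting the points of [F] near [A] expresses separation outside a bounded set without any
    infimum of distances. *)
Definition far_apart (r : R) (A F : set X) : Prop :=
  metric_bounded [set y | F y /\ exists2 a, A a & mdist a y < r].

(* With [F] the complement of the interior of [N], take
   [V = {x | d(x, A) <= d(x, F)}], unfolded so as to avoid the distance to a
   possibly empty set. *)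
Lemma metric_midway_nbhd A N : closed A -> topological_nbhd A N ->
  exists V, [/\ closed V, topological_nbhd A V, topological_nbhd V N &
    forall r, 0 < r -> far_apart (2 * r) A (~` N) ->
      far_apart r A (~` V) /\ far_apart r V (~` N)].
Proof.
move=> cA [G [oG + GN]]; rewrite -(closure_id A).1// => AG.
pose V := [set x | forall y e, (~` N°) y -> 0 < e ->
  exists2 a, A a & mdist x a < mdist x y + e].
have cV : closed V.
  rewrite -[V]setCK; apply: open_closedC; apply/open_mdistP => x /= nVx.
  have [y [e [Fy e0 far]]] : exists y e, [/\ (~` N°) y, 0 < e &
      forall a, A a -> mdist x y + e <= mdist x a].
    apply: contrapT => h; apply: nVx => y e Fy e0.
    apply: contrapT => h'; apply: h; exists y, e; split => // a Aa.
    by rewrite leNgt; apply/negP => xa; apply: h'; exists a.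
  exists (e / 4); first by rewrite divr_gt0.
  move=> z xz Vz.
  have [a /far xa za] : exists2 a, A a & mdist z a < mdist z y + e / 4.
    by apply: Vz => //; rewrite divr_gt0.
  have := metric_triangle x z a; have := metric_triangle z x y.
  by rewrite (metric_sym z x); lra.
have AN : A `<=` N° by apply: (subset_trans AG); rewrite -open_subsetE.
(* Each point outside the interior of [N] is within 1 of a point outside [N] that is still at
   distance less than [r] from [a], so a 1-thickening suffices. *)
have FE r : far_apart r A (~` N) -> far_apart r A (~` N°).
  move=> /(metric_bounded_thickening 1); apply: metric_boundedS.
  move=> y [Fy [a Aa ay]].
  have [z Nz [zy zr]] : exists2 z, ~ N z & mdist y z < 1 /\ mdist a z < r.
    apply: contrapT => h; apply: Fy; apply/nbhs_ballP.
    exists (Num.min 1 (r - mdist a y)) => /=.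
      by rewrite lt_min ltr01 subr_gt0.
    rewrite ballEmdist => z /=; rewrite lt_min => /andP[z1 z2].
    apply: contrapT => Nz; apply: h; exists z => //; split=> //.
    by have := metric_triangle a y z; lra.
  exists z; last by rewrite metric_sym ltW.
  by split => //; exists a.
exists V; split => //.
(* The strict version [d(x, A) < d(x, F)] of [V], with an explicit gap [e]. *)
- exists [set x | exists a e, [/\ A a, 0 < e &
    forall y, (~` N°) y -> mdist x a + e <= mdist x y]]; split.
  + apply/open_mdistP => x [a [e [Aa e0 xae]]].
    exists (e / 4); first by rewrite divr_gt0.
    move=> z xz; exists a, (e / 4); split => // [|y /xae xy].
      by rewrite divr_gt0.
    have := metric_triangle x z y; have := metric_triangle z x a.
    by rewrite (metric_sym z x); lra.
  + rewrite -(closure_id A).1// => x Ax.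
    have /nbhs_ballP[e /= e0 xeN] := AN _ Ax.
    exists x, (e/2); split => //; first by rewrite divr_gt0.
    move=> y Fy; rewrite mdistxx add0r leNgt; apply/negP => xy; apply: Fy.
    apply/nbhs_ballP; exists (e / 2) => /=; first by rewrite divr_gt0.
    rewrite ballEmdist => z /= yz; apply: xeN; rewrite ballEmdist /=.
    by have := metric_triangle x y z; lra.
  + move=> x [a [e [Aa e0 xa]]] y e' Fy e'0; exists a => //.
    by have := xa _ Fy; lra.
- exists N°; split; [exact: open_interior| |exact: interior_subset].
  (* A point of [V] outside the interior of [N] can serve as its own [y], so it lies in the closure
     of [A], that is in [A]: a contradiction. *)
  rewrite -(closure_id V).1// => x Vx; apply: contrapT => Fx.
  apply/Fx/AN; rewrite (closure_id A).1//.
  move=> B /nbhs_ballP[e /= e0]; rewrite ballEmdist => xeB.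
  have [a Aa] := Vx _ _ Fx e0; rewrite mdistxx add0r => xa.
  by exists a; split => //; exact: xeB.
- move=> r r0 /FE AF; split.
  (* If [x] is outside [V] and within [r] of [a], some [y] in [F] is nearer to [x] than [a] is; then
     [d(a, y) < 2r] and [x] is within [r] of [y]. *)
  + apply: metric_boundedS (metric_bounded_thickening r AF).
    move=> x [/= nVx [a Aa ax]].
    apply: contrapT => h; apply: nVx => y e Fy e0.
    exists a => //; rewrite ltNge; apply/negP => xye; apply: h.
    exists y; last by rewrite (metric_sym y); rewrite (metric_sym a) in ax; lra.
    split => //; exists a => //; have := metric_triangle a x y.
    by rewrite (metric_sym x a) in xye; lra.
  + apply: metric_boundedS AF => y [Ny [v Vv vy]].
    have Fy : (~` N°) y by move=> /interior_subset.
    (* The slack [r - d(v, y)] yields [a] in [A] with [d(v, a) < r], hence [d(a, y) < 2r]. *)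
    have e0 : 0 < r - mdist v y by rewrite subr_gt0.
    have [a Aa va] := Vv _ _ Fy e0.
    split => //; exists a => //; have := metric_triangle a v y.
    by rewrite (metric_sym a v); lra.
Qed.

End MetricBounded.

(** * The metric ls-structure *)

Section MetricLs.
Context {R : realType} (X : metricType R).
Implicit Types (A B K N : set X) (U : set (set X)).

(** A point is needed because condition (i) forces the family consisting of the empty set into the
    structure, and some ball must contain that set. *)
Lemma metric_ls_structure : [set: X] !=set0 -> ls_structure (metric_ls X).
Proof.
move=> [x0 _]; split.
- by exists set0, 1.
- move=> U1 U2 [r r0 U1r] U21; exists r => // A U2A.
  have [/(U21 _ U2A)[B /U1r[C Cr BC] AB]|A1] :=
    pselect (exists x y, [/\ A x, A y & x <> y]).
    by exists C => //; exact: subset_trans BC.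
  have [[x Ax]|A0] := pselect (A !=set0); last first.
    by exists (ball x0 r); [exists x0|move=> y Ay; case: A0; exists y].
  exists (ball x r) => [|y Ay]; first by exists x.
  rewrite ballEmdist /=; have [<-|xy] := pselect (x = y).
    by rewrite mdistxx.
  by case: A1; exists x, y.
- move=> U1 U2 [r r0 U1r] [s s0 U2s]; exists (r + 2 * s).
    by rewrite addr_gt0// mulr_gt0.
  move=> _ [V /U1r[_ [x _ <-] Vx] <-]; exists (ball x (r + 2 * s)).
    by exists x.
  move=> y [W [/U2s[_ [w _ <-]] Ww [z [/Ww wz /Vx xz]]] /Ww wy].
  move: wz xz wy; rewrite !ballEmdist /= => wz xz wy.
  have := metric_triangle x z y; have := metric_triangle z w y.
  by rewrite (metric_sym z w); lra.
Qed.

Lemma metric_ls_open_cover :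
  exists U, [/\ metric_ls X U, is_cover U & forall G, U G -> open G].
Proof.
exists (range (fun x : X => ball x 1)); split.
- by exists 1 => // A UA; exists A.
- apply/seteqP; split => // x _; exists (ball x 1); first by exists x.
  by rewrite ballEmdist /= mdistxx.
- move=> _ [x _ <-]; apply/open_mdistP => y; rewrite ballEmdist /= => xy.
  exists (1 - mdist x y); first by rewrite subr_gt0.
  by move=> z yz; have := metric_triangle x y z; lra.
Qed.

Lemma metric_ls_bounded B : [set: X] !=set0 ->
  ls_bounded (metric_ls X) B <-> metric_bounded B.
Proof.
move=> [x0 _]; split => [[U [[r r0 Ur] _ /Ur[_ [x _ <-] Bx]]]|].
  apply/(metric_bounded_atP x); exists r => y /Bx.
  by rewrite ballEmdist => /ltW.
move=> /(metric_bounded_atP x0)[M BM].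
(* Singletons complete [B] to a cover. The radius [|M| + 1] is positive and makes the bound
   strict. *)
exists (B |` range set1); split; last by left.
  exists (`|M| + 1); first by rewrite ltr_wpDl.
  move=> _ [->|[x _ <-]].
    exists (ball x0 (`|M| + 1)); first by exists x0.
    move=> y /BM; rewrite ballEmdist /=; have := ler_norm M; lra.
  exists (ball x (`|M| + 1)); first by exists x.
  by move=> _ ->; rewrite ballEmdist /= mdistxx ltr_wpDl.
by apply/seteqP; split => // x _; exists [set x] => //; right; exists x.
Qed.

(** The cover by [r]-balls tests separation at [r]; conversely, two points in a common [r]-ball are
    less than [2r] apart, so separation at [2r] controls every family refining the [r]-balls. *)
Lemma coarse_nbhd_metric_ls A N : [set: X] !=set0 ->
  coarse_nbhd (metric_ls X) A N <->
  A `<=` N /\ forall r, 0 < r -> far_apart r A (~` N).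
Proof.
move=> X0; have bE K := metric_ls_bounded K X0.
split=> [[AN nbhdN]|[AN far]]; split => //.
  move=> r r0; have [||K /(weakly_bounded_metricP _ bE) bK AK] :=
      nbhdN (range (fun x : X => ball x r)).
  - by exists r => // B UB; exists B.
  - apply/seteqP; split => // x _; exists (ball x r); first by exists x.
    by rewrite ballEmdist /= mdistxx.
  apply: metric_boundedS bK => y [Ny [a Aa ay]].
  have [|/Ny|] // := AK y.
  apply: (@mem_star _ _ (ball a r) _ a) => //.
    by rewrite ballEmdist /= mdistxx.
  by rewrite ballEmdist.
move=> U [r r0 Ur] _; have r2 : 0 < 2 * r by rewrite mulr_gt0.
exists [set y | (~` N) y /\ exists2 a, A a & mdist a y < 2 * r].
  by apply/(weakly_bounded_metricP _ bE); exact: far.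
move=> y [W [/Ur[_ [x _ <-] Wx] [a [/Wx xa Aa]]] /Wx xy].
move: xa xy; rewrite !ballEmdist /= => xa xy.
have [Ny|Ny] := pselect (N y); [by left|right]; split => //; exists a => //.
by have := metric_triangle a x y; rewrite (metric_sym a x); lra.
Qed.

Lemma metric_ls_normal : [set: X] !=set0 -> hls_normal (metric_ls X).
Proof.
move=> X0 A N cA [tN /(coarse_nbhd_metric_ls _ _ X0)[_ far]].
have [V [cV tAV tVN Vfar]] := metric_midway_nbhd cA tN.
have sub B C : topological_nbhd B C -> B `<=` C.
  by move=> [G [_ BG GC]] x /subset_closure/BG/GC.
exists V; split => //; split => //; apply/(coarse_nbhd_metric_ls _ _ X0);
  split; try exact: sub; move=> r r0.
- by apply: (Vfar r r0 _).1; apply: far; rewrite mulr_gt0.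
- by apply: (Vfar r r0 _).2; apply: far; rewrite mulr_gt0.
Qed.

End MetricLs.

(** * The C_0 ls-structure *)

Section C0Ls.
Context {R : realType} (X : metricType R).
Implicit Types (A B K N : set X) (U : set (set X)).

Lemma C0_ls_pointP U : C0_ls X U <-> forall e : R, 0 < e ->
  exists2 B : set X, metric_bounded B & forall W x y,
    U W -> ~ W `<=` B -> W x -> W y -> mdist x y <= e.
Proof.
split=> h e e0; have [B bB BU] := h e e0; exists B => // W.
  by move=> x y UW WB; apply: ((diam_leP W (ltW e0)).1 (BU W UW WB)).
by move=> UW WB; apply/(diam_leP W (ltW e0)) => x y; exact: BU.
Qed.

(** For [e = 1], members not inside [B] have diameter at most 1, so the star lies in [B] together
    with the 1-thickening of [K]. *)
Lemma C0_star_bounded U K :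
  C0_ls X U -> metric_bounded K -> metric_bounded (star K U).
Proof.
move=> /C0_ls_pointP/(_ 1 ltr01)[B bB BU] bK.
apply: metric_boundedS (metric_boundedU bB (metric_bounded_thickening 1 bK)).
move=> y [W [UW [k [Wk Kk]]] Wy].
have [WB|WB] := pselect (W `<=` B); first by left; exact: WB.
by right; exists k => //; exact: BU WB _ _.
Qed.

Lemma C0_ls_structure : ls_structure (C0_ls X).
Proof.
split.
- by exists set0; apply/C0_ls_pointP => e e0; exists set0 => //;
    apply/metric_boundedP; exists 0.
- move=> U1 U2 /C0_ls_pointP U1C0 U21; apply/C0_ls_pointP => e e0.
  have [B bB BU] := U1C0 e e0; exists B => // W x y U2W WB Wx Wy.
  have [<-|xy] := pselect (x = y); first by rewrite mdistxx ltW.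
  have [|C U1C WC] := U21 W U2W; first by exists x, y.
  apply: (BU C) => //; try exact: WC.
  by move=> CB; apply: WB; exact: subset_trans CB.
- move=> U1 U2 U1C0 U2C0; apply/C0_ls_pointP => e e0.
  have e3 : 0 < e / 3 by rewrite divr_gt0.
  have [B1 bB1 BU1] := (C0_ls_pointP U1).1 U1C0 _ e3.
  have [B2 bB2 BU2] := (C0_ls_pointP U2).1 U2C0 _ e3.
  (* If the star of [V] leaves this set, then [V] is not inside [B1] and misses [B2]. Hence [V], and
     the members [W] and [Z] meeting it, all have diameter at most [e / 3]. *)
  exists (star B1 U2 `|` star (star B2 U1) U2).
    by apply: metric_boundedU; do ?apply: C0_star_bounded.
  move=> _ x y [V U1V <-] VB [W [U2W [p [Wp Vp]]] Wx] [Z [U2Z [q [Zq Vq]]] Zy].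
  have VB1 : ~ V `<=` B1.
    by move=> VB1; apply: VB => z /(starS VB1); left.
  have VB2 z : V z -> ~ B2 z.
    move=> Vz B2z; apply: VB => t Vt; right; apply: starS Vt => u Vu.
    exact: (mem_star U1V Vz).
  have xp : mdist x p <= e / 3 by apply: (BU2 W) => // /(_ _ Wp)/VB2.
  have qy : mdist q y <= e / 3 by apply: (BU2 Z) => // /(_ _ Zq)/VB2.
  have pq : mdist p q <= e / 3 by exact: (BU1 V).
  have := metric_triangle x p y; have := metric_triangle p q y; lra.
Qed.

(* Balls whose radius decays with the distance of the centre to a base point. *)
Lemma C0_ls_open_cover :
  exists U, [/\ C0_ls X U, is_cover U & forall G, U G -> open G].
Proof.
have [[x0 _]|X0] := pselect ([set: X] !=set0); last first.
  exists set0; split => //.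
  - by apply/C0_ls_pointP => e e0; exists set0 => //;
      apply/metric_boundedP; exists 0.
  - by apply/seteqP; split => // x; case: X0; exists x.
pose rad x : R := (1 + mdist x0 x)^-1.
have rad0 x : 0 < rad x by rewrite invr_gt0 ltr_pwDl// mdist_ge0.
exists (range (fun x : X => ball x (rad x))); split.
(* A radius above [e / 2] puts the centre within [2 / e] of [x0], and radii are at most 1, so such a
   ball lies in this set; the other balls have diameter at most [e]. *)
- apply/C0_ls_pointP => e e0; exists [set y | mdist x0 y <= 2 / e + 1].
    by apply/(metric_bounded_atP x0); exists (2 / e + 1).
  move=> _ y z [x _ <-] + xy xz.
  move: xy xz; rewrite !ballEmdist /= => xy xz far.
  have rade : rad x <= e / 2.
    rewrite leNgt; apply/negP => erad; apply: far => t /= xt.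
    have rad1 : rad x <= 1.
      by rewrite invf_le1 ?lerDl ?mdist_ge0// ltr_pwDl// mdist_ge0.
    have : mdist x0 x < 2 / e.
      move: erad; rewrite -invf_div ltf_pV2 ?posrE ?divr_gt0//.
        by have := mdist_ge0 x0 x; lra.
      by rewrite ltr_pwDl// mdist_ge0.
    by have := metric_triangle x0 x t; lra.
  by have := metric_triangle y x z; rewrite (metric_sym y x); lra.
- apply/seteqP; split => // x _; exists (ball x (rad x)); first by exists x.
  by rewrite ballEmdist /= mdistxx.
- move=> _ [x _ <-]; apply/open_mdistP => y; rewrite ballEmdist /= => xy.
  exists (rad x - mdist x y); first by rewrite subr_gt0.
  by move=> z yz; have := metric_triangle x y z; lra.
Qed.

(** For the converse, [B] and the singletons form a cover in which [B] itself is the exceptional set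
    for every [e]. *)
Lemma C0_ls_bounded B : ls_bounded (C0_ls X) B <-> metric_bounded B.
Proof.
split => [[U [/C0_ls_pointP/(_ 1 ltr01)[C bC CU] _ UB]]|bB].
  have [BC|BC] := pselect (B `<=` C); first exact: metric_boundedS bC.
  by apply/metric_boundedP; exists 1 => x y; exact: CU.
exists (B |` range set1); split; last by left.
  apply/C0_ls_pointP => e e0; exists B => // _ x y [->|[z _ <-] _ -> ->]; first by case.
  by rewrite mdistxx ltW.
by apply/seteqP; split => // x _; exists [set x] => //; right; exists x.
Qed.

Lemma C0_ls_pairs (p : nat -> X * X) :
  (forall n, mdist (p n).1 (p n).2 < n.+1%:R^-1) ->
  C0_ls X (range (fun n => [set (p n).1; (p n).2]) `|` range set1).
Proof.
move=> pn; apply/C0_ls_pointP => e e0; pose m := Num.truncn e^-1.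
(* Only the finitely many indices [n < m] have [1 / (n + 1) >= e], and a finite union of pairs is
   bounded. *)
exists (\bigcup_(n in `I_m) [set (p n).1; (p n).2]).
  elim: m => [|m IH].
    by rewrite II0 bigcup_set0; apply/metric_boundedP; exists 0.
  rewrite IIS bigcup_setU bigcup_set1; apply: metric_boundedU => //.
  exact: metric_bounded2.
move=> _ x y [[n _ <-]|[z _ <-]]; last by move=> _ -> ->; rewrite mdistxx ltW.
move=> nm; have mn : (m <= n)%N.
  by rewrite leqNgt; apply/negP => lt_nm; apply: nm => z; exists n.
have /ltW ne : mdist (p n).1 (p n).2 < e.
  apply: lt_trans (pn n) _; rewrite invf_plt ?posrE//.
  by apply: lt_le_trans (truncnS_gt _) _; rewrite ler_nat ltnS.
by move=> [] -> [] -> //; rewrite ?mdistxx ?(ltW e0)// metric_sym.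
Qed.

(* If [A] and the complement of [N] come arbitrarily close near infinity, then
   pairs of points realising this form, with the singletons, a uniformly bounded
   cover whose star on [A] leaves [N] in an unbounded set. *)
Lemma coarse_nbhd_C0_ls A N :
  coarse_nbhd (C0_ls X) A N <->
  A `<=` N /\ exists2 r, 0 < r & far_apart r A (~` N).
Proof.
have bP K := weakly_bounded_metricP K C0_ls_bounded.
split=> [[AN nbhdN]|[AN [r r0 far]]]; split => //.
  apply: contrapT => nfar.
  have {}nfar r : 0 < r -> ~ far_apart r A (~` N).
    by move=> r0 far; apply: nfar; exists r.
  have [x0 _] : [set: X] !=set0.
    apply: contrapT => X0; apply: (nfar 1) => //; apply/metric_boundedP.
    by exists 0 => x; case: X0; exists x.
  have /choice[p pP] n : exists p : X * X, [/\ A p.1, ~ N p.2,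
      mdist p.1 p.2 < n.+1%:R^-1 & n%:R < mdist x0 p.2].
    apply: contrapT => h; apply: (nfar n.+1%:R^-1); first by rewrite invr_gt0.
    apply/(metric_bounded_atP x0); exists n%:R => y [Ny [a Aa ay]].
    by rewrite leNgt; apply/negP => ny; apply: h; exists (a, y).
  have [||K /bP/(metric_bounded_atP x0)[M KM] AK] :=
      nbhdN (range (fun n => [set (p n).1; (p n).2]) `|` range set1).
  - by apply: C0_ls_pairs => n; have [] := pP n.
  - by apply/seteqP; split => // x _; exists [set x] => //; right; exists x.
  (* This index exceeds [M], so its point outside [N] is too far from [x0] to lie in [K]. *)
  have [Ap Np _ Mp] := pP (Num.truncn M).+1.
  have [|/Np|/KM] // := AK (p (Num.truncn M).+1).2.
    apply: (@mem_star _ _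
      [set (p (Num.truncn M).+1).1; (p (Num.truncn M).+1).2] _
      (p (Num.truncn M).+1).1) => //; [|by left|by right].
    by left; exists (Num.truncn M).+1.
  by have := truncnS_gt M; lra.
move=> U /C0_ls_pointP UC0 _; have r2 : 0 < r / 2 by rewrite divr_gt0.
(* Members not inside [B] have diameter at most [r / 2 < r], so where they meet [A] and leave [N]
   they stay in the bounded set given by [far]. *)
have [B bB BU] := UC0 _ r2.
exists (B `|` [set y | (~` N) y /\ exists2 a, A a & mdist a y < r]).
  by apply/bP; exact: metric_boundedU.
move=> y [W [UW [a [Wa Aa]]] Wy].
have [Ny|Ny] := pselect (N y); [by left|right].
have [WB|WB] := pselect (W `<=` B); [left; exact: WB|right].
by split => //; exists a => //; have := BU W a y UW WB Wa Wy; lra.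
Qed.

Lemma C0_ls_normal : hls_normal (C0_ls X).
Proof.
move=> A N cA [tN /coarse_nbhd_C0_ls[_ [r r0 far]]].
have [V [cV tAV tVN Vfar]] := metric_midway_nbhd cA tN.
have sub B C : topological_nbhd B C -> B `<=` C.
  by move=> [G [_ BG GC]] x /subset_closure/BG/GC.
have r2 : 0 < r / 2 by rewrite divr_gt0.
have [|AV VN] := Vfar _ r2; first by rewrite mulrC divfK.
by exists V; split => //; split => //; apply/coarse_nbhd_C0_ls;
  split; try exact: sub; exists (r / 2).
Qed.

End C0Ls.

Theorem proposition6p4 (R : realType) (X : metricType R) :
  ([set: X] !=set0 ->
     hls_space (metric_ls X) /\ hls_normal (metric_ls X)) /\
  (hls_space (C0_ls X) /\ hls_normal (C0_ls X)).
Proof.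
split=> [X0|]; (split; first split).
- exact: metric_ls_structure.
- exact: metric_ls_open_cover.
- exact: metric_ls_normal.
- exact: C0_ls_structure.
- exact: C0_ls_open_cover.
- exact: C0_ls_normal.
Qed.
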